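(* Let $X$ be a reflexive smooth Banach space over $\mathbb{C}$ and $T\in B(X)$. Then $T$ is unitary if and only if $T$ is a surjective isometry.
   Context: $B(X)$ is the space of bounded linear operators on $X$, $S_X=\{x\in X:\|x\|=1\}$, $X^*$ is the space of bounded linear functionals on $X$. $X$ is smooth if every $x\in S_X$ admits a unique $x^*\in S_{X^*}$ with $x^*(x)=1$. The duality mapping $J:X\to X^*$ of a smooth Banach space assigns to each $x$ the unique functional $J(x)$ with $\|J(x)\|=\|x\|$ and $J(x)(x)=\|x\|^2$; write $Jx=J(x)$. For $T\in B(X)$ the transpose $T':X^*\to X^*$ is $(T'f)(x)=f(Tx)$. An operator $T\in B(X)$ on a smooth Banach space is called unitary if $\|Tx\|=\|T'Jx\|=\|x\|$ for all $x\in X$. *)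

(* Defs.v *)
From HB Require Import structures.
From mathcomp Require Import all_boot all_order all_algebra.
From mathcomp Require Export complex.
From mathcomp Require Import all_classical all_reals all_analysis.

Set Implicit Arguments.
Unset Strict Implicit.
Unset Printing Implicit Defensive.

Import Order.TTheory GRing.Theory Num.Theory.
Import numFieldNormedType.Exports.
Local Open Scope classical_set_scope.
Local Open Scope complex_scope.
Local Open Scope ring_scope.

(* The complex field is [R[i]] for [R : realType]; the norm of a
   [normedModType R[i]] takes its values in [R[i]], where [x <= y] means that
   [y - x] is a nonnegative real. *)

Section BoundedLinear.
Context {R : realType}.
Implicit Types X Y : normedModType R[i].

Definition bounded_linear X Y : {pred X -> Y} :=
  mem [set f : X -> Y | linear f /\
        exists M : R[i], forall x, `|f x| <= M * `|x|].

Record blin X Y := Blin {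
  blin_fun :> X -> Y;
  blinP : blin_fun \in @bounded_linear X Y }.

End BoundedLinear.
Arguments bounded_linear {R} X Y.

Section BlinLmodule.
Context {R : realType} (X Y : normedModType R[i]).

HB.instance Definition _ := [isSub for @blin_fun R X Y].
HB.instance Definition _ := [Choice of blin X Y by <:].

Lemma blin_linear (f : blin X Y) : linear f.
Proof. by have := blinP f; rewrite inE => -[]. Qed.

HB.instance Definition _ (f : blin X Y) :=
  GRing.isLinear.Build R[i] X Y *:%R f (blin_linear f).

Lemma blin_bounded (f : blin X Y) :
  exists2 M : R[i], 0 <= M & forall x, `|f x| <= M * `|x|.
Proof.
have := blinP f; rewrite inE => -[_ [M HM]]; exists `|M| => // x.
have [->|x0] := eqVneq x 0; first by rewrite raddf0 !normr0 mulr0.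
rewrite (le_trans (HM x))// ler_wpM2r// real_ler_norm// ger0_real//.
by rewrite -(pmulr_lge0 _ (_ : 0 < `|x|)) ?normr_gt0// (le_trans _ (HM x)).
Qed.

Lemma bounded_linear_submod : submod_closed (bounded_linear X Y).
Proof.
split.
  rewrite inE; split; first by move=> a u v /=; rewrite scaler0 addr0.
  by exists 0 => x; rewrite normr0 mul0r.
move=> a f g fP gP.
have [M _ HM] := blin_bounded (Blin fP); have [N _ HN] := blin_bounded (Blin gP).
have fL := blin_linear (Blin fP); have gL := blin_linear (Blin gP).
rewrite inE; split.
  move=> b u v /=; rewrite !fctE /= [f _]fL [g _]gL /=.
  by rewrite !scalerDr addrACA !scalerA mulrC.
exists (`|a| * M + N) => x; rewrite mulrDl -mulrA.
rewrite (_ : (a *: f + g) x = a *: f x + g x)//.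
apply: (le_trans (ler_normD _ _)); apply: lerD; last exact: HN.
by rewrite normrZ ler_wpM2l//; exact: HM.
Qed.

HB.instance Definition _ := GRing.isSubmodClosed.Build _ _ (bounded_linear X Y)
  bounded_linear_submod.
HB.instance Definition _ := [SubChoice_isSubLmodule of blin X Y by <:].

(* The supremum is taken in [R] and embedded back into [R[i]]. *)
Definition opnorm (f : blin X Y) : R[i] :=
  (sup [set complex.Re `|f x| | x in [set x : X | `|x| <= 1]])%:C.

Lemma normE (Z : normedModType R[i]) (z : Z) : (complex.Re `|z|)%:C = `|z|.
Proof. by rewrite RRe_real// ger0_real. Qed.

Lemma opnorm_has_sup (f : blin X Y) :
  has_sup [set complex.Re `|f x| | x in [set x : X | `|x| <= 1]].
Proof.
split; first by exists (complex.Re `|f 0|), 0 => //=; rewrite normr0.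
have [M M0 HM] := blin_bounded f; exists (complex.Re M) => _ [x /= x1 <-].
have := le_trans (HM x) (ler_wpM2l M0 x1).
by rewrite mulr1 lecE => /andP[_].
Qed.

Lemma le_opnorm (f : blin X Y) x : `|f x| <= opnorm f * `|x|.
Proof.
have [->|x0] := eqVneq x 0; first by rewrite raddf0 !normr0 mulr0.
have x0' : 0 < `|x| by rewrite normr_gt0.
rewrite -ler_pdivrMr// mulrC -[`|x|^-1]ger0_norm ?invr_ge0// -normrZ.
rewrite -linearZ -[leLHS]normE /opnorm lecR.
apply: ub_le_sup; first by case: (opnorm_has_sup f).
exists (`|x|^-1 *: x) => //=.
by rewrite normrZ ger0_norm ?invr_ge0// mulVf// gt_eqF.
Qed.

Lemma opnorm_le (f : blin X Y) (M : R[i]) :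
  (forall x, `|x| <= 1 -> `|f x| <= M) -> opnorm f <= M.
Proof.
move=> HM; have M0 : 0 <= M by rewrite (le_trans _ (HM 0 _))// normr0.
rewrite -[M]RRe_real ?ger0_real// /opnorm lecR; apply: ge_sup.
  by case: (opnorm_has_sup f).
by move=> _ [x /= x1 <-]; have := HM x x1; rewrite lecE => /andP[].
Qed.

Lemma opnorm_ge0 (f : blin X Y) : 0 <= opnorm f.
Proof.
rewrite /opnorm lecR (le_trans _ (ub_le_sup (proj2 (opnorm_has_sup f)) (_ : _ (complex.Re `|f 0|))))//.
  by rewrite raddf0 normr0.
by exists 0 => //=; rewrite normr0.
Qed.

Lemma opnormD (f g : blin X Y) : opnorm (f + g) <= opnorm f + opnorm g.
Proof.
apply: opnorm_le => x x1.
rewrite (_ : (f + g) x = f x + g x)//.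
rewrite (le_trans (ler_normD _ _))// lerD//.
  by rewrite (le_trans (le_opnorm f x))// ler_piMr// opnorm_ge0.
by rewrite (le_trans (le_opnorm g x))// ler_piMr// opnorm_ge0.
Qed.

Lemma opnorm0_eq0 (f : blin X Y) : opnorm f = 0 -> f = 0.
Proof.
move=> f0; apply: val_inj; apply/funext => x /=.
have := le_opnorm f x; rewrite f0 mul0r normr_le0 => /eqP ->.
by [].
Qed.

Lemma opnormZ (a : R[i]) (f : blin X Y) : opnorm (a *: f) = `|a| * opnorm f.
Proof.
have le b g : opnorm (b *: g) <= `|b| * opnorm g.
  apply: opnorm_le => x x1; rewrite (_ : (b *: g) x = b *: g x)// normrZ.
  rewrite ler_wpM2l// (le_trans (le_opnorm g x))// ler_piMr//.
  exact: opnorm_ge0.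
apply/eqP; rewrite eq_le le /=.
have [->|a0] := eqVneq a 0; first by rewrite normr0 mul0r opnorm_ge0.
rewrite -ler_pdivlMl ?normr_gt0// -normfV.
by rewrite -[X in opnorm X <= _](scalerK a0) le.
Qed.

HB.instance Definition _ := Lmodule_isNormed.Build R[i] (blin X Y)
  opnormD opnormZ opnorm0_eq0.

Lemma blin_normE (f : blin X Y) : `|f| = opnorm f.
Proof. by []. Qed.

End BlinLmodule.

Definition dual {R : realType} (X : normedModType R[i]) : normedModType R[i] :=
  blin X R[i]^o.

Section Notions.
Context {R : realType} (X : normedModType R[i]).

Lemma transpose_subproof (T : blin X X) (f : dual X) :
  (fun x => f (T x)) \in bounded_linear X R[i]^o.
Proof.
rewrite inE; split; first by move=> a u v /=; rewrite !linearP.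
exists (opnorm f * opnorm T) => x; rewrite -mulrA.
by rewrite (le_trans (le_opnorm f _))// ler_wpM2l ?opnorm_ge0// le_opnorm.
Qed.

Definition transpose (T : blin X X) (f : dual X) : dual X :=
  Blin (transpose_subproof T f).

Lemma eval_at_subproof (x : X) :
  (fun f : dual X => f x) \in bounded_linear (dual X) R[i]^o.
Proof.
rewrite inE; split=> //.
by exists `|x| => f; rewrite mulrC; exact: le_opnorm.
Qed.

Definition eval_at (x : X) : dual (dual X) := Blin (eval_at_subproof x).

Definition reflexive_space : Prop :=
  forall F : dual (dual X), exists x : X, eval_at x = F.

Definition smooth : Prop :=
  forall x : X, `|x| = 1 -> exists! f : dual X, `|f| = 1 /\ f x = 1.

(* Meaningful when [X] is smooth: then such a functional exists and is unique
   for every [x]; otherwise [xget] makes a choice. *)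
Definition duality_map (x : X) : dual X :=
  xget 0 [set f : dual X | `|f| = `|x| /\ f x = `|x| ^+ 2].

Definition unitary (T : blin X X) : Prop :=
  forall x : X, `|T x| = `|x| /\ `|transpose T (duality_map x)| = `|x|.

Definition surjective_isometry (T : blin X X) : Prop :=
  (forall x : X, `|T x| = `|x|) /\ (forall y : X, exists x : X, T x = y).

End Notions.

(* Main.v *)
Require Import Defs.
From mathcomp Require Import all_boot all_order all_algebra.
From mathcomp Require Import all_classical all_reals all_analysis.
From mathcomp Require Import lra ring.

(** The delicate implication is that a unitary [T] is surjective.  Being an
    isometry of a complete space, [T] has closed range
    ([isometry_range_closed]).  If the range were proper, the Hahn-Banach
    theorem would give a nonzero functional [g] vanishing on it
    ([range_annihilator]), that is, [T' g = 0].  In a reflexive space every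
    functional attains its norm, and in a smooth one this says that the duality
    map is onto ([duality_map_surjective]), so [g = J x] for some [x].  Then
    [`|x| = `|T' (J x)| = `|T' g| = 0] forces [g = J x = 0], a contradiction.

    Conversely, composition with a surjective isometry preserves the norm of
    every functional, and [`|J x| = `|x|].

    The Hahn-Banach theorem is proved here from Zorn's lemma in a form that
    avoids partially defined functionals: the minimal elements among the
    sublinear functions on the whole space are exactly what is needed, since a
    minimal sublinear function is linear.  Real and complex linearity are both
    expressed on a complex vector space, and the complex form, for a seminorm
    [p], follows through [f x = q x - i q (i x)].  It is applied to the norm of
    a space, to the norm of its dual, and to the distance to the range of an
    operator. *)

Set Implicit Arguments.
Unset Strict Implicit.
Unset Printing Implicit Defensive.

Import Order.TTheory GRing.Theory Num.Theory.
Import numFieldNormedType.Exports.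
Local Open Scope classical_set_scope.
Local Open Scope complex_scope.
Local Open Scope ring_scope.

(** * Infima of sets of reals *)

Section Infimum.
Context {R : realType}.
Implicit Types (A B : set R) (c t : R).

Lemma le_infD A B c : A !=set0 -> B !=set0 ->
  (forall a b, A a -> B b -> c <= a + b) -> c <= inf A + inf B.
Proof.
move=> A0 B0 cAB; rewrite -lerBlDr; apply: lb_le_inf => // a Aa.
rewrite lerBlDr -lerBlDl; apply: lb_le_inf => // b Bb.
by rewrite lerBlDl; exact: cAB.
Qed.

Lemma le_infM A t c : A !=set0 -> 0 <= t ->
  (forall a, A a -> c <= t * a) -> c <= t * inf A.
Proof.
move=> [a0 Aa0]; rewrite le_eqVlt => /predU1P[<-|t0] cA.
  by rewrite mul0r; have := cA _ Aa0; rewrite mul0r.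
rewrite -ler_pdivrMl//; apply: lb_le_inf; first by exists a0.
by move=> a Aa; rewrite ler_pdivrMl//; exact: cA.
Qed.

End Infimum.

(** * Sublinear functions and the real Hahn-Banach theorem *)

Section Sublinear.
Context {R : realType} {V : lmodType R[i]}.
Implicit Types (p q : V -> R) (x y : V) (t : R).

(** Homogeneity is required only as an inequality, which is easier to establish
    for an infimum; [sublinear0] and [sublinearZ] recover the equalities. *)
Definition sublinear q :=
  (forall x y, q (x + y) <= q x + q y) /\
  (forall t x, 0 <= t -> q (t%:C *: x) <= t * q x).

Lemma sublinear0 q : sublinear q -> q 0 = 0.
Proof.
move=> [qD qZ]; apply/eqP; rewrite eq_le; apply/andP; split.
  by have := qZ 0 0 (lexx _); rewrite scaler0 mul0r.
by have := qD 0 0; rewrite addr0 lerDl.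
Qed.

Lemma sublinearZ q t x : sublinear q -> 0 <= t -> q (t%:C *: x) = t * q x.
Proof.
move=> Sq; rewrite le_eqVlt => /predU1P[<-|t0].
  by rewrite scale0r mul0r sublinear0.
apply/eqP; rewrite eq_le (Sq.2 _ _ (ltW t0))/= -ler_pdivlMl//.
have tx : x = t^-1%:C *: (t%:C *: x).
  by rewrite scalerA -rmorphM mulVf ?gt_eqF// scale1r.
by rewrite [in leLHS]tx; apply: Sq.2; rewrite invr_ge0 ltW.
Qed.

Lemma sublinear_geN q x : sublinear q -> - q (- x) <= q x.
Proof.
move=> Sq; rewrite -subr_ge0 opprK -(sublinear0 Sq) -[in leLHS](subrr x).
exact: Sq.1.
Qed.

(** Taking [t = 0] shows [slide q y <= q], and taking [t = 1] at the point [- y]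
    shows [slide q y (- y) <= - q y], the least value that a sublinear function
    agreeing with [q] at [y] can have there.  The infimum is finite because
    [q (t *: y) = t * q y] makes [- q (- x)] a lower bound. *)
Definition slide q y x : R :=
  inf [set q (x + t%:C *: y) - t * q y | t in [set t | 0 <= t]].

Lemma slide_le q y x t : sublinear q -> 0 <= t ->
  slide q y x <= q (x + t%:C *: y) - t * q y.
Proof.
move=> Sq t0; apply: ge_inf; last by exists t.
exists (- q (- x)) => _ [s /= s0 <-].
rewrite -(sublinearZ _ Sq s0) lerBrDl lerBlDr.
by rewrite -[in leLHS](addrK x (s%:C *: y)) [_ + x]addrC; exact: Sq.1.
Qed.

Lemma slide_sublinear q y : sublinear q -> sublinear (slide q y).
Proof.
move=> Sq.
have S0 x :
    [set q (x + t%:C *: y) - t * q y | t in [set t | 0 <= t]] !=set0.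
  by exists (q (x + 0%:C *: y) - 0 * q y), 0 => /=.
split=> [x x'|t x t0].
  apply: le_infD => // _ _ [t /= t0 <-] [t' /= t0' <-].
  apply: le_trans (slide_le _ _ Sq (addr_ge0 t0 t0')) _.
  have := Sq.1 (x + t%:C *: y) (x' + t'%:C *: y).
  by rewrite addrACA -scalerDl -rmorphD; lra.
apply: le_infM => // _ [s /= s0 <-].
apply: le_trans (slide_le _ _ Sq (mulr_ge0 t0 s0)) _.
by rewrite rmorphM -scalerA -scalerDr sublinearZ// mulrBr mulrA.
Qed.

Lemma slide_lel q y x : sublinear q -> slide q y x <= q x.
Proof.
move=> Sq; apply: le_trans (slide_le _ _ Sq (lexx 0)) _.
by rewrite scale0r addr0 mul0r subr0.
Qed.

(** If [q] is not already additive on the line through [y], then [slide q y] is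
    strictly below [q] at [- y]: this makes minimal sublinear functions odd. *)
Lemma slideN q y : sublinear q -> slide q y (- y) <= - q y.
Proof.
move=> Sq; apply: le_trans (slide_le _ _ Sq ler01) _.
by rewrite scale1r addNr (sublinear0 Sq) mul1r sub0r.
Qed.

(** The chain hypothesis is what makes subadditivity survive the infimum: two
    members can be replaced by the smaller one.  Members are bounded below at
    [x] by [- p (- x)], hence the bound [p]. *)
Lemma inf_chain_sublinear p (A : set (V -> R)) : A !=set0 ->
  (forall q, A q -> sublinear q /\ forall x, q x <= p x) ->
  total_on A (fun q r => forall x, r x <= q x) ->
  let m x := inf [set q x | q in A] in
  sublinear m /\ forall q x, A q -> m x <= q x.
Proof.
move=> A0 Ap totA m.
have mle q x : A q -> m x <= q x.
  move=> Aq; apply: ge_inf; last by exists q.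
  exists (- p (- x)) => _ [r /Ap[Sr rp] <-].
  by rewrite (le_trans _ (sublinear_geN x Sr))// lerN2.
have S0 x : [set q x | q in A] !=set0.
  by case: A0 => q Aq; exists (q x), q.
split=> //; split=> [x y|t x t0].
  apply: le_infD => // _ _ [q Aq <-] [r Ar <-].
  have [[Sq _] [Sr _]] := (Ap _ Aq, Ap _ Ar).
  have [qr|rq] := totA _ _ Aq Ar.
    rewrite (le_trans (mle r _ Ar))// (le_trans (Sr.1 _ _))//.
    by rewrite lerD2r qr.
  rewrite (le_trans (mle q _ Aq))// (le_trans (Sq.1 _ _))//.
  by rewrite lerD2l rq.
apply: le_infM => // _ [q Aq <-]; have [Sq _] := Ap _ Aq.
by rewrite (le_trans (mle q _ Aq))// Sq.2.
Qed.

Lemma minimal_sublinear p : sublinear p ->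
  exists q, [/\ sublinear q, forall x, q x <= p x &
    forall r, sublinear r -> (forall x, r x <= q x) -> r = q].
Proof.
move=> Sp; pose T := {q : V -> R | sublinear q /\ forall x, q x <= p x}.
pose le (q r : T) := `[< forall x, sval r x <= sval q x >].
have [||||[q [Sq qp]] qmin] := @Zorn T le.
- by move=> q; apply/asboolP.
- move=> q r s /asboolP qr /asboolP rs; apply/asboolP => x.
  exact: le_trans (rs x) (qr x).
- move=> [q ?] [r ?] /asboolP/= qr /asboolP/= rq; apply: eq_exist.
  by apply/funext => x; apply/eqP; rewrite eq_le rq qr.
- move=> A totA; have [[q0 Aq0]|A0] := pselect (A !=set0); last first.
    (* The empty chain is bounded by [p] itself. *)
    exists (exist _ p (conj Sp (fun=> lexx _))) => s As.
    by case: A0; exists s.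
  have [||| Sm mle] := @inf_chain_sublinear p [set sval q | q in A].
  + by exists (sval q0), q0.
  + by move=> _ [q _ <-]; exact: (svalP q).
  + move=> _ _ [q Aq <-] [r Ar <-].
    by have [/asboolP|/asboolP] := totA _ _ Aq Ar; [left|right].
  have mp x : inf [set q x | q in [set sval q | q in A]] <= p x.
    rewrite (le_trans (mle (sval q0) x _))//; first by exists q0.
    by have [_] := svalP q0.
  exists (exist _ _ (conj Sm mp) : T) => s As; apply/asboolP => x /=.
  by apply: mle; exists s.
exists q; split=> // r Sr rq.
have rp x : r x <= p x := le_trans (rq x) (qp x).
have := qmin (exist _ r (conj Sr rp)) (introT (asboolP _) rq).
by move/(congr1 sval).
Qed.

(** Minimality gives [slide q y = q], so [q (- y) <= - q y] by [slideN]; an odd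
    sublinear function is linear. *)
Lemma minimal_sublinear_linear q : sublinear q ->
  (forall r, sublinear r -> (forall x, r x <= q x) -> r = q) ->
  (forall x y, q (x + y) = q x + q y) /\
  (forall t x, q (t%:C *: x) = t * q x).
Proof.
move=> Sq qmin.
have qN y : q (- y) = - q y.
  apply/eqP; rewrite eq_le; apply/andP; split; last first.
    by have := sublinear_geN (- y) Sq; rewrite opprK.
  have qy : slide q y = q.
    by apply: qmin; [exact: slide_sublinear|move=> x; exact: slide_lel].
  by have := slideN y Sq; rewrite qy.
split=> [x y|t x].
  apply/eqP; rewrite eq_le Sq.1/=.
  have := Sq.1 (x + y) (- y); rewrite addrK qN; lra.
have [t0|/ltW t0] := leP 0 t; first exact: sublinearZ.
rewrite -[in LHS](opprK t) rmorphN scaleNr qN.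
by rewrite sublinearZ ?oppr_ge0// mulNr opprK.
Qed.

(** Minimizing below [slide p x0] rather than below [p] forces
    [q (- x0) <= - p x0], hence [q x0 = p x0] for the linear [q] obtained. *)
Theorem real_hahn_banach p x0 : sublinear p -> exists q,
  [/\ forall x y, q (x + y) = q x + q y, forall t x, q (t%:C *: x) = t * q x,
      forall x, q x <= p x & q x0 = p x0].
Proof.
move=> Sp.
have [q [Sq qs qmin]] := minimal_sublinear (slide_sublinear x0 Sp).
have [qD qZ] := minimal_sublinear_linear Sq qmin.
have qp x : q x <= p x := le_trans (qs x) (slide_lel x0 x Sp).
exists q; split=> //; apply/eqP; rewrite eq_le qp/= -lerN2.
have -> : - q x0 = q (- x0).
  by rewrite -mulN1r -qZ rmorphN scaleN1r.
exact: le_trans (qs _) (slideN x0 Sp).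
Qed.

End Sublinear.

(** * The complex Hahn-Banach theorem *)

Section ComplexHahnBanach.
Context {R : realType}.
Implicit Types V : lmodType R[i].

Lemma complexify_linear V (q : V -> R) :
  (forall x y, q (x + y) = q x + q y) ->
  (forall t x, q (t%:C *: x) = t * q x) ->
  linear (fun x => (q x +i* - q ('i%C *: x)) : R[i]^o).
Proof.
move=> qD qZ [a b] u v.
have E w : (a +i* b) *: w = a%:C *: w + b%:C *: ('i%C *: w) :> V.
  rewrite scalerA -scalerDl; congr (_ *: _).
  by apply/eqP; rewrite eq_complex /=; apply/andP; split; apply/eqP; ring.
have ii (w : V) : 'i%C *: ('i%C *: w) = (-1)%:C *: w.
  rewrite scalerA; congr (_ *: _).
  by apply/eqP; rewrite eq_complex /=; apply/andP; split; apply/eqP; ring.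
have iE : 'i%C *: ((a +i* b) *: u) = (a +i* b) *: ('i%C *: u).
  by rewrite !scalerA mulrC.
rewrite scalerDr iE !qD !E !qD !qZ ii qZ; apply/eqP; rewrite eq_complex /=.
by apply/andP; split; apply/eqP; ring.
Qed.

Lemma complex_phase (z : R[i]) : exists2 u : R[i], `|u| = 1 & u * z = `|z|.
Proof.
have [->|z0] := eqVneq z 0; first by exists 1; rewrite ?normr1// mulr0 normr0.
exists (`|z| / z); last by rewrite divfK.
by rewrite normf_div normr_id divff// normr_eq0.
Qed.

(** With [f x = q x - i q (i x)], the bound on [q] becomes a bound on [`|f x|]
    after rotating [x] by a phase that makes [f x] real and nonnegative.  At
    [x0] the real part of [f x0] already has the maximal modulus [p x0], so the
    imaginary part vanishes. *)
Theorem complex_hahn_banach V (p : V -> R) x0 :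
  (forall x y, p (x + y) <= p x + p y) ->
  (forall a x, p (a *: x) <= complex.Re `|a| * p x) ->
  exists f : V -> R[i]^o, [/\ linear f, forall x, `|f x| <= (p x)%:C &
    f x0 = (p x0)%:C].
Proof.
move=> pD pZ.
have Sp : sublinear p.
  split=> // t x t0; by have := pZ t%:C x; rewrite ger0_norm ?lecR.
have [q [qD qZ qp qx0]] := real_hahn_banach x0 Sp.
pose f x : R[i]^o := q x +i* - q ('i%C *: x).
have fL : linear f := complexify_linear qD qZ.
have fp x : `|f x| <= (p x)%:C.
  have [u u1 ufx] := complex_phase (f x).
  have fux : f (u *: x) = `|f x|.
    have := fL u x 0; rewrite addr0 => ->.
    have f0 : f 0 = 0.
      have q0 : q 0 = 0 by rewrite -(scale0r 0) qZ mul0r.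
      by rewrite /f scaler0 q0 oppr0.
    by rewrite f0 addr0.
  have -> : `|f x| = (complex.Re (f (u *: x)))%:C.
    by rewrite fux RRe_real ?normr_real.
  by rewrite lecR (le_trans (qp _))// (le_trans (pZ _ _))// u1 mul1r.
exists f; split=> //; apply/eqP; rewrite eq_complex /= qx0 eqxx/=.
have p0 : 0 <= (p x0)%:C := le_trans (normr_ge0 _) (fp x0).
have : `|f x0| ^+ 2 <= (p x0)%:C ^+ 2.
  by apply: lerXn2r; rewrite ?nnegrE ?normr_ge0 ?p0 ?fp.
rewrite -add_Re2_Im2 -rmorphXn lecR /= qx0 gerDl => im0.
by rewrite -sqrf_eq0 eq_le im0 sqr_ge0.
Qed.

End ComplexHahnBanach.

(** * Functionals on normed spaces *)

Section DualSpace.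
Context {R : realType}.
Implicit Types X Y : normedModType R[i].

Lemma dual_opnorm_le X (f : dual X) x : `|f x| <= `|f| * `|x|.
Proof. exact: le_opnorm. Qed.

Lemma Re_norm_le X (x : X) (M : R) : (complex.Re `|x| <= M) = (`|x| <= M%:C).
Proof. by rewrite -[in RHS]normE lecR. Qed.

Lemma Re_norm_ge0 X (x : X) : 0 <= complex.Re `|x|.
Proof. by rewrite -lecR normE; exact: normr_ge0. Qed.

Lemma dominated_dual X (f : X -> R[i]^o) : linear f ->
  (forall x, `|f x| <= `|x|) -> exists g : dual X, g =1 f /\ `|g| <= 1.
Proof.
move=> fL fx.
have fB : f \in bounded_linear X R[i]^o.
  by rewrite inE; split=> //; exists 1 => x; rewrite mul1r.
exists (Blin fB); split=> //.
by apply: opnorm_le => x; exact: le_trans.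
Qed.

Lemma norming_functional X (x0 : X) :
  exists f : dual X, `|f| <= 1 /\ f x0 = `|x0|.
Proof.
have [||f [fL fp fx0]] :=
  @complex_hahn_banach R X (fun x => complex.Re `|x|) x0.
- by move=> x y; rewrite Re_norm_le rmorphD /= !normE ler_normD.
- by move=> a x; rewrite Re_norm_le rmorphM /= (normE (a : R[i]^o)) normE normrZ.
have [|g [gf g1]] := dominated_dual fL; first by move=> x; rewrite -normE fp.
by exists g; split=> //; rewrite gf fx0 normE.
Qed.

Definition range_dist Y X (T : blin Y X) x : R :=
  inf [set complex.Re `|x - T z| | z in [set: Y]].

Lemma range_dist_le Y X (T : blin Y X) x z :
  range_dist T x <= complex.Re `|x - T z|.
Proof.
apply: ge_inf; last by exists z.
by exists 0 => _ [y _ <-]; exact: Re_norm_ge0.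
Qed.

Lemma range_dist_ge0 Y X (T : blin Y X) x : 0 <= range_dist T x.
Proof.
apply: lb_le_inf; first by exists (complex.Re `|x - T 0|), 0.
by move=> _ [y _ <-]; exact: Re_norm_ge0.
Qed.

Lemma range_distD Y X (T : blin Y X) x y :
  range_dist T (x + y) <= range_dist T x + range_dist T y.
Proof.
apply: le_infD.
- by exists (complex.Re `|x - T 0|), 0.
- by exists (complex.Re `|y - T 0|), 0.
move=> _ _ [z _ <-] [w _ <-].
rewrite (le_trans (range_dist_le _ _ (z + w)))// Re_norm_le rmorphD /= !normE.
by rewrite linearD opprD addrACA ler_normD.
Qed.

Lemma range_distZ Y X (T : blin Y X) a x :
  range_dist T (a *: x) <= complex.Re `|a| * range_dist T x.
Proof.
apply: le_infM.
- by exists (complex.Re `|x - T 0|), 0.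
- exact: (Re_norm_ge0 (a : R[i]^o)).
move=> _ [z _ <-].
rewrite (le_trans (range_dist_le _ _ (a *: z)))// Re_norm_le rmorphM /=.
by rewrite (normE (a : R[i]^o)) normE linearZ -scalerBr normrZ.
Qed.

(** The distance to the range is a seminorm dominated by the norm and null on
    the range, so Hahn-Banach for it yields a functional of the right kind. *)
Lemma range_annihilator Y X (T : blin Y X) x0 : 0 < range_dist T x0 ->
  exists2 g : dual X, g x0 != 0 & forall z, g (T z) = 0.
Proof.
move=> dx0.
have [f [fL fd fx0]] :=
  complex_hahn_banach x0 (range_distD T) (range_distZ T).
have [|g [gf _]] := dominated_dual fL.
  move=> x; rewrite (le_trans (fd x))// -normE lecR.
  by rewrite (le_trans (range_dist_le T x 0))// linear0 subr0.
exists g.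
  by rewrite gf fx0; apply/eqP => -[d0]; rewrite d0 ltxx in dx0.
move=> z; apply/eqP; rewrite -normr_le0 gf (le_trans (fd _))// lecR.
by rewrite (le_trans (range_dist_le T (T z) z))// subrr normr0.
Qed.

(** The sets of [z] such that [T z] is close to [x0] form a Cauchy filter because
    [T] preserves distances, and its limit is mapped to [x0]. *)
Lemma isometry_range_closed (Y : completeNormedModType R[i]) X
    (T : blin Y X) x0 :
  (forall z, `|T z| = `|z|) -> range_dist T x0 = 0 -> exists z, T z = x0.
Proof.
move=> Tiso d0.
pose B (e : R) := [set z : Y | complex.Re `|x0 - T z| < e].
have B0 e : 0 < e -> B e !=set0.
  move=> e0; have [|_ [z _ <-] ze] := @inf_adherent R
    [set complex.Re `|x0 - T z| | z in [set: Y]] e e0.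
    split; first by exists (complex.Re `|x0 - T 0|), 0.
    by exists 0 => _ [y _ <-]; exact: Re_norm_ge0.
  by exists z; move: ze; rewrite -/(range_dist T x0) d0 add0r.
pose F : set_system Y := filter_from [set e : R | 0 < e] B.
have FF : ProperFilter F.
  apply: filter_from_proper; last by move=> e; exact: B0.
  apply: filter_from_filter; first by exists 1 => /=.
  move=> e e' /= e0 e0'; exists (Num.min e e'); first by rewrite /= lt_min e0.
  by move=> z; rewrite /B /= lt_min => /andP[].
have Fc : cauchy F.
  apply: cauchy_exP => e e0.
  have e20 : 0 < complex.Re e / 2.
    by rewrite divr_gt0// -ltcR (RRe_real (gtr0_real e0)).
  have [z Bz] := B0 _ e20; exists z, (complex.Re e / 2) => // w Bw.
  rewrite -ball_normE /ball_ /= -Tiso linearB -normE.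
  rewrite -(RRe_real (gtr0_real e0)) ltcR.
  have : complex.Re `|T z - T w| <=
      complex.Re `|x0 - T z| + complex.Re `|x0 - T w|.
    rewrite Re_norm_le rmorphD /= !normE (distrC x0 (T z)).
    exact: ler_distD.
  by move: Bz Bw; rewrite /B /=; lra.
have Fl := cauchy_cvg F Fc.
exists (lim F); apply/eqP; rewrite eq_sym -subr_eq0 -normr_le0 -normE lecR.
apply/ler_addgt0Pr => e e0; rewrite add0r.
have e20 : 0 < e / 2 by rewrite divr_gt0.
have lF : F (ball (lim F) (e / 2)%:C).
  by apply: Fl; apply: nbhsx_ballx; rewrite ltcR.
have BF : F (B (e / 2)) by exists (e / 2).
have [z []] := filter_ex (filterI lF BF).
rewrite -ball_normE /ball_ /= -Tiso linearB -normE ltcR /B /= => h1 h2.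
have : complex.Re `|x0 - T (lim F)| <=
    complex.Re `|T (lim F) - T z| + complex.Re `|x0 - T z|.
  rewrite Re_norm_le rmorphD /= !normE [leRHS]addrC (distrC (T (lim F))).
  exact: ler_distD.
lra.
Qed.

(** * The duality map *)

Section Duality.
Context {X : normedModType R[i]} (Xsmooth : smooth X).

Definition dual_pair (x : X) (f : dual X) := `|f| = `|x| /\ f x = `|x| ^+ 2.

Lemma dual_pair_exists x : exists f, dual_pair x f.
Proof.
have [f [f1 fx]] := norming_functional x.
exists (`|x| *: f).
have fxx : (`|x| *: f) x = `|x| ^+ 2.
  by rewrite (_ : (_ *: f) x = `|x| * f x)// fx.
split=> //; apply/eqP; rewrite eq_le; apply/andP; split.
  by rewrite normrZ normr_id ler_piMr.
have [->|x0] := eqVneq x 0; first by rewrite normr0.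
have := dual_opnorm_le (`|x| *: f) x.
by rewrite fxx normrX normr_id expr2 ler_pM2r// normr_gt0.
Qed.

(** Smoothness concerns unit vectors only; dividing [x] and the functional by
    [`|x|] reduces to that case. *)
Lemma dual_pair_unique x f g : dual_pair x f -> dual_pair x g -> f = g.
Proof.
move=> [fn fx] [gn gx].
have [x0|x0] := eqVneq x 0.
  by move: fn gn; rewrite x0 normr0 => /normr0_eq0 -> /normr0_eq0 ->.
have nx : `|x| != 0 by rewrite normr_eq0.
pose y := `|x|^-1 *: x.
have y1 : `|y| = 1 by rewrite normrZ normfV normr_id mulVf.
have norming h : dual_pair x h ->
    `|(`|x|^-1 *: h)| = 1 /\ (`|x|^-1 *: h) y = 1.
  move=> [hn hx]; split; first by rewrite normrZ normfV normr_id hn mulVf.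
  rewrite (_ : (_ *: h) y = `|x|^-1 * h y)// linearZ /= hx.
  by rewrite /GRing.scale /= expr2 mulKf// mulVf.
have [h [_ hu]] := Xsmooth y1.
apply: (@scalerI _ _ `|x|^-1); first by rewrite invr_eq0.
by rewrite -(hu _ (norming _ (conj fn fx))) (hu _ (norming _ (conj gn gx))).
Qed.

Lemma duality_mapP x : dual_pair x (duality_map x).
Proof.
by have [f fP] := dual_pair_exists x; exact: (xgetI 0 fP).
Qed.

(** A norming functional for [g] on the dual is, by reflexivity, evaluation at a
    point [x] of the unit ball, where [g x = `|g|]; then [`|g| *: x] is the
    preimage of [g]. *)
Lemma duality_map_surjective : reflexive_space X ->
  forall g : dual X, exists x, duality_map x = g.
Proof.
move=> Xrefl g.
have [F [F1 Fg]] := norming_functional g.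
have [x xF] := Xrefl F.
have gx : g x = `|g| by rewrite -Fg -xF.
have x1 : `|x| <= 1.
  have [f [f1 fx]] := norming_functional x.
  have : `|F f| <= `|F| * `|f| by exact: dual_opnorm_le.
  rewrite -xF (_ : eval_at x f = `|x|)// normr_id => /le_trans; apply.
  by rewrite xF mulr_ile1.
exists (`|g| *: x); apply: dual_pair_unique; first exact: duality_mapP.
have gxx : g (`|g| *: x) = `|g| ^+ 2 by rewrite linearZ /= gx.
suff nx : `|(`|g| *: x)| = `|g| by split; rewrite nx.
apply/eqP; rewrite eq_le normrZ normr_id ler_piMr//=.
by have := dual_opnorm_le g x; rewrite gx normr_id.
Qed.

End Duality.
End DualSpace.

(** * Unitary operators *)

Theorem theorem11 (R : realType) (X : completeNormedModType R[i])
    (hrefl : reflexive_space X) (hsmooth : smooth X) (T : blin X X) :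
  unitary T <-> surjective_isometry T.
Proof.
split=> [Tu|[Tiso Tsurj] x].
  have Tiso x : `|T x| = `|x| by have [] := Tu x.
  split=> // y; apply: isometry_range_closed => //.
  apply/eqP; apply: contraT => dy.
  have /range_annihilator[g gy gT] : 0 < range_dist T y.
    by rewrite lt_neqAle eq_sym dy range_dist_ge0.
  have [x Jx] := duality_map_surjective hsmooth hrefl g.
  have Tg0 : transpose T g = 0.
    by apply: val_inj; apply/funext => z; exact: gT.
  have [_] := Tu x; rewrite Jx Tg0 normr0 => x0.
  have [] := duality_mapP x; rewrite Jx -x0 => /normr0_eq0 g0.
  by rewrite g0 eqxx in gy.
split=> //.
have [<- _] := duality_mapP x; set f := duality_map x.
apply/eqP; rewrite eq_le; apply/andP; split.
  apply: opnorm_le => y y1; rewrite (le_trans (dual_opnorm_le f (T y)))//.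
  by rewrite Tiso ler_piMr.
apply: opnorm_le => y y1; have [z zy] := Tsurj y; rewrite -zy in y1 *.
rewrite (le_trans (dual_opnorm_le (transpose T f) z))//.
by rewrite ler_piMr// -Tiso.
Qed.
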